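(* Let $d,n\ge 1$ be integers. Let $\phi$ be the chain in $(os_n^d,\leq)$ defined by $\phi(i)=(i,\dots,i)$ for all $0\le i<n$. Then $L_n^d=\mathrm{Tam}\big((os_n^d,\leq),\phi\big)$, where an element $((x_1,\dots,x_d),i)$ of $\mathcal{C}_{os_n^d}^{\phi}$ is identified with $(x_1,\dots,x_d,i)\in os_n^{d+1}$.
   Context: $os_n^{d}$ is the set of non-decreasing sequences $x=(x_1,\dots,x_d)$ of elements of $\{0,1,\dots,n-1\}$, ordered by the product (componentwise) order $\leq$. $L_n^d$ is the lattice, ordered by inclusion, of the $d$-torsion classes of the $(d-1)$-Auslander algebra of type $\mathbf{A}_n$. By a theorem of August et al., these are identified with the subsets $T\subseteq os_n^{d+1}$ satisfying the following two conditions, which we take as the definition of the elements of $L_n^d$: (1) for all $0\le i<n$, $\{x\in T\mid x_{d+1}=i\}$ is an order filter (up-closed subset) of the poset $\{x\in os_n^{d+1}\mid x_{d+1}=i\}$ with the product order; (2) for all $x,z\in T$ such that $x_1\le z_1-1\le x_2\le z_2-1\le\cdots\le x_{d+1}\le z_{d+1}-1$, every $y\in os_n^{d+1}$ with $y_i\in\{x_i,z_i\}$ for each $i$ belongs to $T$. For a finite poset $P$ and a chain $\phi(0)<\cdots<\phi(n-1)$ in $P$: let $\mathcal{C}_i=\{x\in P\mid x\le\phi(i)\}\times\{i\}$ for $0\le i<n$, ordered by $(x,i)\le(y,i)$ iff $x\le y$, and $\mathcal{C}_P^{\phi}=\bigsqcup_{0\le i<n}\mathcal{C}_i$ the disjoint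 union of posets (different components incomparable). An order filter $T$ of $\mathcal{C}_P^{\phi}$ is torclosed if for all $0\le i<j<n$ and all $x$, $(x,i)\in T$ and $(\phi(i+1),j)\in T$ imply $(x,j)\in T$. $\mathrm{Tam}(P,\phi)$ is the lattice of torclosed subsets of $\mathcal{C}_P^{\phi}$ ordered by inclusion. *)

(* Defs.v *)
From HB Require Import structures.
From mathcomp Require Import all_boot all_order.
Set Implicit Arguments.
Unset Strict Implicit.
Unset Printing Implicit Defensive.
Import Order.TTheory.

Record os (n d : nat) := OS {
  os_val :> d.-tupleprod 'I_n;
  os_sorted : sorted <=%O (os_val : seq 'I_n)
}.

HB.instance Definition _ n d := [isSub for @os_val n d].
HB.instance Definition _ n d := [Finite of os n d by <:].
Fact os_display : Order.disp_t. Proof. exact: Order.Disp tt tt. Qed.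
HB.instance Definition _ n d :=
  [SubChoice_isSubPOrder of os n d by <: with os_display].

Definition coord n d (x : os n d) (k : 'I_d) : 'I_n := tnth (os_val x) k.

Lemma leEos n d (x y : os n d) :
  (x <= y)%O = [forall k : 'I_d, coord x k <= coord y k].
Proof.
rewrite -[LHS]/(os_val x <= os_val y)%O Order.TupleProdOrder.leEtprod.
by apply: eq_forallb => k; rewrite leEord.
Qed.

(* [A] is an order filter of the subposet of [P] carried by [S] *)
Definition order_filter disp (P : finPOrderType disp) (S A : {set P}) : bool :=
  (A \subset S) && [forall x in A, forall y in S, (x <= y)%O ==> (y \in A)].

(* x_1 <= z_1 - 1 <= x_2 <= z_2 - 1 <= ... <= x_d <= z_d - 1; the inequality
   x_k <= z_k - 1 between integers is x_k < z_k, which also makes the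
   truncated predecessor of z_k its true predecessor *)
Definition interlaced n d (x z : os n d) : bool :=
  [forall k : 'I_d, coord x k < coord z k] &&
  [forall k : 'I_d, forall l : 'I_d,
     (l == k.+1 :> nat) ==> ((coord z k).-1 <= coord x l)].

(* the subsets of [os n d.+1] that correspond to the d-torsion classes *)
Definition L n d : {set {set os n d.+1}} :=
  [set T : {set os n d.+1} |
     [forall i : 'I_n,
        order_filter [set x | coord x ord_max == i]
                     [set x in T | coord x ord_max == i]]
  && [forall x in T, forall z in T, interlaced x z ==>
        [forall y, [forall k, coord y k \in [:: coord x k; coord z k]]
                   ==> (y \in T)]]].

Record chain disp (P : finPOrderType disp) (n : nat) := Chain {
  chain_fun :> 'I_n -> P;
  chain_lt : forall i j : 'I_n, i < j -> (chain_fun i < chain_fun j)%O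
}.

Section Tamari.
Variables (disp : Order.disp_t) (P : finPOrderType disp) (n : nat).
Variable phi : chain P n.

(* the disjoint union over i of the posets {x | x <= phi i}: distinct
   components are incomparable, see [Cle] *)
Record Cpos := CPos {
  cval :> P * 'I_n;
  cval_le : (cval.1 <= phi cval.2)%O
}.

HB.instance Definition _ := [isSub for cval].
HB.instance Definition _ := [Finite of Cpos by <:].

Definition Cle (a b : Cpos) : bool :=
  (a.2 == b.2) && (a.1 <= b.1)%O.

Fact Cle_refl : reflexive Cle.
Proof. by move=> a; rewrite /Cle eqxx lexx. Qed.

Fact Cle_anti : antisymmetric Cle.
Proof.
move=> a b /andP[/andP[/eqP e2 le_ab] /andP[_ le_ba]]; apply: val_inj.
have e1 : a.1 = b.1 by apply/le_anti; rewrite le_ab le_ba.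
by rewrite /= [cval a]surjective_pairing [cval b]surjective_pairing e1 e2.
Qed.

Fact Cle_trans : transitive Cle.
Proof.
move=> b a c /andP[/eqP e1 le_ab] /andP[/eqP e2 le_bc].
by rewrite /Cle e1 e2 eqxx (le_trans le_ab le_bc).
Qed.

HB.instance Definition _ :=
  Order.Le_isPOrder.Build disp Cpos Cle_refl Cle_anti Cle_trans.

(* [(x, i) \in cval @: T] says that (x, i) is an element of the poset and is
   in [T]; the index [k] is i + 1 *)
Definition torclosed (T : {set Cpos}) : bool :=
  [forall i : 'I_n, forall j : 'I_n, forall k : 'I_n, forall x : P,
     [&& i < j, k == i.+1 :> nat, (x, i) \in cval @: T
       & (phi k, j) \in cval @: T] ==> ((x, j) \in cval @: T)].

Definition Tam : {set {set Cpos}} :=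
  [set T : {set Cpos} | order_filter setT T && torclosed T].

End Tamari.

Section Diagonal.
Variables n d : nat.

Fact diag_sorted (i : 'I_n) : sorted <=%O (nseq d i).
Proof. by case: d => //= m; elim: m => //= m ->; rewrite lexx. Qed.

Definition diag (i : 'I_n) : os n d :=
  @OS n d (nseq_tuple d i) (diag_sorted i).

Hypothesis d_gt0 : 0 < d.

Fact diag_lt (i j : 'I_n) : i < j -> (diag i < diag j)%O.
Proof.
move=> ltij; rewrite lt_neqAle; apply/andP; split.
  apply/eqP => /(congr1 (fun x => nat_of_ord (coord x (Ordinal d_gt0)))).
  by rewrite /coord /= !tnth_nseq => eij; rewrite eij ltnn in ltij.
rewrite leEos; apply/forallP => k.
by rewrite /coord /= !tnth_nseq ltnW.
Qed.

Definition diag_chain : chain (os n d) n := Chain diag_lt.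

Fact rcons_sorted (c : Cpos diag_chain) :
  sorted <=%O (rcons (os_val c.1) c.2).
Proof.
case: c => [[x i] /=]; rewrite leEos => /forallP le_xi.
rewrite (sorted_pairwise le_trans) pairwise_rcons.
rewrite -(sorted_pairwise le_trans) os_sorted andbT.
apply/all_tnthP => k; have := le_xi k.
by rewrite /coord /= tnth_nseq leEord.
Qed.

Definition ident (c : Cpos diag_chain) : os n d.+1 :=
  @OS n d.+1 (rcons_tuple (os_val c.1) c.2) (rcons_sorted c).

End Diagonal.

Arguments diag_chain n d d_gt0 : clear implicits.
Arguments ident {n d d_gt0} c.

(* Main.v *)
Require Import Defs.
From mathcomp Require Import all_boot all_order.
From mathcomp Require Import zify.
Set Implicit Arguments.
Unset Strict Implicit.
Unset Printing Implicit Defensive.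
Import Order.TTheory.

(** Both families are described inside [os n d.+1], where being an order filter
    of the disjoint union means being up-closed among the points with a given
    last coordinate. For such a set [T], torclosedness gives condition (2): if
    [x] and [z] are interlaced with last coordinates [i < j], then
    [(i+1, ..., i+1, j)] lies above [z], hence in [T], so that
    [(x_1, ..., x_d, j)] is in [T]; and [y] lies above [x] or above this point.
    Conversely, given [(x, i)] and [(i+1, ..., i+1, j)] in [T], one shows
    [(x_1, ..., x_m, i+1, ..., i+1, j)] in [T] by induction on [m]: condition (2)
    is applied to [(x_1, ..., x_(m+1), i, ..., i)], which lies above [(x, i)],
    and [(x_2 + 1, ..., x_(m+1) + 1, i+1, ..., i+1, j)], which lies above the
    point obtained for [m]. *)

(** * Sorted tuples handled coordinate by coordinate *)

Lemma coord_inj n d (x y : os n d) :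
  (forall k, coord x k = coord y k :> nat) -> x = y.
Proof.
by move=> exy; apply/le_anti; rewrite !leEos; apply/andP; split;
   apply/forallP => k; rewrite exy.
Qed.

Lemma coord_mono n d (x : os n d) (k l : 'I_d) :
  k <= l -> coord x k <= coord x l.
Proof.
move=> le_kl; have sx := os_sorted x.
have x0 := coord x k.
suff : (coord x k <= coord x l)%O by rewrite leEord.
rewrite /coord !(tnth_nth x0).
by apply: (sorted_leq_nth le_trans lexx x0 sx) => //;
   rewrite inE size_tuple ltn_ord.
Qed.

(** Points given by piecewise formulas on natural indices can thus be built with arithmetic side
    conditions only. *)
Lemma os_of_fun n d (f : nat -> nat) :
    (forall k, k < d -> f k < n) ->
    (forall k l, k <= l -> l < d -> f k <= f l) ->
  exists x : os n d, forall k, coord x k = f k :> nat.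
Proof.
move=> ltf monf.
pose t := [tuple Ordinal (ltf k (ltn_ord k)) | k < d].
suff st : sorted <=%O (t : seq 'I_n).
  by exists (@OS n d t st) => k; rewrite /coord /= tnth_mktuple.
(* The default value [x0] is read off the tuple itself, so the empty tuple is treated apart. *)
case: d => [|d] in ltf monf t *; first by rewrite (tuple0 t).
have x0 := tnth t ord0.
apply/(sortedP x0) => i; rewrite size_tuple => lt_i1.
rewrite -!(tnth_nth x0 t (Ordinal lt_i1)).
rewrite -(tnth_nth x0 t (Ordinal (ltnW lt_i1))) !tnth_mktuple leEord /=.
exact: monf.
Qed.

(** * Closure conditions inside [os n d.+1] *)

Section Slices.
Variables n d : nat.
Implicit Types (T : {set os n d.+1}) (x y z : os n d.+1).

(** Condition (1) for all slices at once, the common last coordinate replacing the index of the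
    slice. *)
Definition slice_closed T : Prop :=
  forall x y, x \in T -> coord x ord_max = coord y ord_max -> (x <= y)%O ->
    y \in T.

Definition interlace_closed T : Prop :=
  forall x z y, x \in T -> z \in T -> interlaced x z ->
    (forall k, coord y k \in [:: coord x k; coord z k]) -> y \in T.

(* torclosedness read through [ident]: [x], [z] and [y] stand for [(x, i)],
   [(phi (i + 1), j)] and [(x, j)] *)
Definition slice_torclosed T : Prop :=
  forall x z y, x \in T -> z \in T ->
    coord x ord_max < coord z ord_max ->
    (forall k : 'I_d.+1, k < d -> coord z k = (coord x ord_max).+1 :> nat) ->
    (forall k : 'I_d.+1, k < d -> coord y k = coord x k) ->
    coord y ord_max = coord z ord_max -> y \in T.

Lemma in_L T : reflect (slice_closed T /\ interlace_closed T) (T \in L n d).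
Proof.
rewrite inE; apply: (iffP andP) => [[/forallP sT /forallP iT] | [sT iT]]; split.
- move=> x y xT exy le_xy.
  have /andP[_ /forallP/(_ x)/implyP] := sT (coord x ord_max).
  rewrite inE xT eqxx => /(_ isT)/forallP/(_ y)/implyP.
  by rewrite inE -exy eqxx => /(_ isT)/implyP/(_ le_xy); rewrite inE => /andP[].
- move=> x z y xT zT xz yxz.
  move: (iT x) => /implyP/(_ xT)/forallP/(_ z)/implyP/(_ zT)/implyP/(_ xz).
  by move/forallP/(_ y)/implyP; apply; apply/forallP.
- apply/forallP => i; apply/andP; split.
    by apply/subsetP => x; rewrite !inE => /andP[].
  apply/forallP => x; apply/implyP; rewrite inE => /andP[xT /eqP xi].
  apply/forallP => y; apply/implyP; rewrite inE => /eqP yi.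
  by apply/implyP => le_xy; rewrite inE yi eqxx andbT (sT x) // xi yi.
- apply/forallP => x; apply/implyP => xT; apply/forallP => z; apply/implyP => zT.
  apply/implyP => xz; apply/forallP => y; apply/implyP => /forallP yxz.
  exact: iT xT zT xz yxz.
Qed.

Lemma ord_maxVlt (k : 'I_d.+1) : k = ord_max \/ k < d.
Proof.
case: (ltnP k d) => [|le_dk]; [by right | left].
by apply/val_inj => /=; apply/eqP; rewrite eqn_leq le_dk -ltnS ltn_ord.
Qed.

Lemma slice_torclosed_interlace T : 0 < d ->
  slice_closed T -> slice_torclosed T -> interlace_closed T.
Proof.
move=> d_gt0 sT tT x z y xT zT /andP[/forallP lt_xz /forallP le_zx] yxz.
have le_xy k : coord x k <= coord y k.
  by have := yxz k; rewrite !inE => /orP[] /eqP -> //; exact: ltnW.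
have := yxz ord_max; rewrite !inE => /orP[] /eqP y_max.
  by apply: sT xT _ _ => //; rewrite leEos; apply/forallP.
set i := coord x ord_max; set j := coord z ord_max.
have lt_ij : i < j := lt_xz ord_max.
(* The last interlacing inequality reads z_d - 1 <= x_(d+1) = i, and [z] is non-decreasing; position
   d is the index [d.-1], which precedes [ord_max] because [d] is positive. *)
have le_zi (k : 'I_d.+1) : k < d -> coord z k <= i.+1.
  move=> lt_kd; have lt_d1 : d.-1 < d.+1 by lia.
  have le_kd1 : k <= Ordinal lt_d1 by rewrite /=; lia.
  apply: leq_trans (coord_mono z le_kd1) _.
  have := le_zx (Ordinal lt_d1) => /forallP/(_ ord_max)/implyP.
  by rewrite /= prednK // eqxx => /(_ isT); rewrite /i; lia.
have lt_jn := ltn_ord j.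
(* [w] is (i+1, ..., i+1, j), and [v], built next, is (x_1, ..., x_d, j). *)
have [w wE] : exists w : os n d.+1,
    forall k, coord w k = (if k < d then i.+1 else j) :> nat.
  by apply: (@os_of_fun n d.+1 (fun k => if k < d then i.+1 else j)) => /= k *;
     do ![case: ifP => //]; lia.
have [v vE] : exists v : os n d.+1,
    forall k : 'I_d.+1, coord v k = (if k < d then coord x k else j) :> nat.
  have [|k l le_kl lt_l|v vE] := @os_of_fun n d.+1
      (fun k => if k < d then coord x (inord k) else j).
  - by move=> k *; case: ifP.
  - case: (ltnP l d) => [lt_ld|_].
      by rewrite (leq_ltn_trans le_kl lt_ld) coord_mono // !inordK //; lia.
    case: ifP => // _; apply: leq_trans (ltnW lt_ij).
    by apply: coord_mono; rewrite -ltnS.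
  - by exists v => k; rewrite vE inord_val.
have wT : w \in T.
  apply: sT zT _ _; first by apply/val_inj; rewrite /= wE ltnn.
  rewrite leEos; apply/forallP => k; rewrite wE.
  by case: (ord_maxVlt k) => [->|lt_kd]; rewrite ?ltnn // lt_kd le_zi.
have vT : v \in T.
  apply: (tT x w) => //; rewrite -/i.
  - by rewrite wE ltnn.
  - by move=> k lt_kd; rewrite wE lt_kd.
  - by move=> k lt_kd; apply/val_inj; rewrite /= vE lt_kd.
  - by apply/val_inj; rewrite /= vE wE !ltnn.
apply: sT vT _ _; first by apply/val_inj; rewrite /= vE ltnn y_max.
rewrite leEos; apply/forallP => k; rewrite vE.
by case: (ord_maxVlt k) => [->|lt_kd]; rewrite ?ltnn ?y_max // lt_kd.
Qed.

Lemma interlace_slice_torclosed T :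
  slice_closed T -> interlace_closed T -> slice_torclosed T.
Proof.
move=> sT iT x z y xT zT; set i := coord x ord_max; set j := coord z ord_max.
move=> lt_ij zi yx yj; have lt_jn := ltn_ord j.
pose xf k : nat := coord x (inord k).
have xfE (k : 'I_d.+1) : coord x k = xf k :> nat by rewrite /xf inord_val.
have xf_mono k l : k <= l -> l <= d -> xf k <= xf l.
  by move=> *; apply: coord_mono; rewrite !inordK; lia.
have xf_i k : k <= d -> xf k <= i.
  by move=> *; apply: coord_mono; rewrite inordK /=; lia.
(* Indices start at 0: [wf m] keeps the first [m] coordinates of [x], so that [wf 0] describes [z]
   and [wf d] describes [y]. *)
pose wf m k : nat := if k < m then xf k else if k < d then i.+1 else j.
suff wT m : m <= d -> forall w : os n d.+1,
    (forall k, coord w k = wf m k :> nat) -> w \in T.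
  apply: (wT d) => // k; rewrite /wf.
  by case: (ord_maxVlt k) => [->|lt_kd]; rewrite ?ltnn ?yj // lt_kd yx // xfE.
elim: m => [_ w wE | m IHm lt_md w wE].
  suff -> : w = z by [].
  apply: coord_inj => k; rewrite wE /wf ltn0.
  by case: (ord_maxVlt k) => [->|lt_kd]; rewrite ?ltnn // lt_kd zi.
have [u uE] : exists u : os n d.+1, forall k, coord u k = wf m k :> nat.
  apply: os_of_fun => [k | k l] *; rewrite /wf; last have := xf_mono k l.
    by have := xf_i k; do ![case: ifP => //]; lia.
  by have := xf_i k; do ![case: ifP => //]; lia.
have {IHm}uT : u \in T by apply: IHm => //; exact: ltnW.
(* Before its last coordinate, [bf] is as large as interlacing with [af] permits: [bf k] is
   [(af k.+1).+1] for every [k < d]. This puts [b] above [u]. *)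
pose af k := if k <= m then xf k else i : nat.
pose bf k := if k < m then (xf k.+1).+1 else if k < d then i.+1 else j.
have [a aE] : exists a : os n d.+1, forall k, coord a k = af k :> nat.
  apply: os_of_fun => [k | k l] *; rewrite /af; last have := xf_mono k l.
    by have := xf_i k; do ![case: ifP => //]; lia.
  by have := xf_i k; do ![case: ifP => //]; lia.
have [b bE] : exists b : os n d.+1, forall k, coord b k = bf k :> nat.
  apply: os_of_fun => [k | k l] *; rewrite /bf; last have := xf_mono k.+1 l.+1.
    by have := xf_i k.+1; do ![case: ifP => //]; lia.
  by have := xf_i k.+1; do ![case: ifP => //]; lia.
have aT : a \in T.
  apply: sT xT _ _.
    by apply/val_inj; rewrite /= aE /af leqNgt lt_md.
  rewrite leEos; apply/forallP => k; rewrite aE /af xfE.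
  by case: ifP => // _; apply: xf_i; rewrite -ltnS.
have bT : b \in T.
  apply: sT uT _ _.
    by apply/val_inj; rewrite /= uE bE /bf /wf ltnn ltnNge (ltnW lt_md).
  rewrite leEos; apply/forallP => k; rewrite uE bE /wf /bf.
  by case: ifP => // lt_km; apply/leqW/xf_mono; lia.
apply: (iT a b) => //; last first.
  (* [w] agrees with [a] up to index [m] and with [b] after it. *)
  move=> k; rewrite !inE -!val_eqE /= wE aE bE /wf /af /bf ltnS.
  case: (leqP k m) => [_|lt_mk]; first by rewrite eqxx.
  by rewrite (leq_gtF (ltnW lt_mk)) eqxx orbT.
apply/andP; split; apply/forallP => k.
  rewrite aE bE /af /bf; have := xf_mono k k.+1; have := xf_i k.
  by do ![case: ifP]; lia.
apply/forallP => l; apply/implyP => /eqP lk; rewrite aE bE /af /bf lk.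
(* The bound on [l] forces [k < d], which excludes the value [j] of [bf]. *)
by have := ltn_ord l; rewrite lk; do ![case: ifP]; lia.
Qed.

End Slices.

(** * Transport along the identification *)

Section Ident.
Variables (n d : nat) (d_gt0 : 0 < d).
Local Notation C := (Cpos (diag_chain n d d_gt0)).
Implicit Types (a b c : C) (T : {set C}).

Lemma coord_ident_max c : coord (ident c) ord_max = c.2.
Proof.
rewrite /coord (tnth_nth c.2) /= nth_rcons size_tuple ltnn eqxx //.
Qed.

Lemma coord_ident_lt c (k : 'I_d) (l : 'I_d.+1) :
  k = l :> nat -> coord (ident c) l = coord c.1 k.
Proof.
move=> kl; rewrite /coord !(tnth_nth c.2) /= nth_rcons size_tuple -kl.
by rewrite ltn_ord.
Qed.

(** Equal second components are essential: across components the images may be comparable while the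
    points are not. *)
Lemma ident_le a b : a.2 = b.2 -> (ident a <= ident b)%O = (a <= b)%O.
Proof.
move=> ab2; rewrite -[RHS]/((a.2 == b.2) && (a.1 <= b.1)%O) ab2 eqxx /=.
rewrite !leEos; apply/forallP/forallP => le_ab k.
  have := le_ab (widen_ord (leqnSn d) k).
  by rewrite !(@coord_ident_lt _ k).
case: (ord_maxVlt k) => [->|lt_kd]; first by rewrite !coord_ident_max ab2.
by rewrite !(@coord_ident_lt _ (Ordinal lt_kd)).
Qed.

Lemma ident_inj : injective (@ident n d d_gt0).
Proof.
move=> a b eab; have ab2 : a.2 = b.2 by rewrite -!coord_ident_max eab.
by apply/le_anti; rewrite -!ident_le // eab lexx.
Qed.

Lemma Cpos_of_pair (x : os n d) (i : 'I_n) :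
  (forall k, coord x k <= i) -> exists c : C, val c = (x, i).
Proof.
move=> le_xi; suff le_x : ((x, i).1 <= diag_chain n d d_gt0 (x, i).2)%O.
  by exists (CPos le_x).
by rewrite leEos; apply/forallP => k; rewrite /= {2}/coord tnth_nseq.
Qed.

(** The last coordinate of a sorted tuple bounds the others, so cutting it off leaves a point below
    the corresponding diagonal element. *)
Lemma ident_surj (x : os n d.+1) : exists c : C, ident c = x.
Proof.
have [k|k l le_kl lt_ld|y yE] := @os_of_fun n d (fun k => coord x (inord k)).
- by [].
- by apply: coord_mono; rewrite !inordK; lia.
have [k|c cE] := @Cpos_of_pair y (coord x ord_max).
  by rewrite yE coord_mono // -ltnS.
exists c; apply: coord_inj => k.
have [c1 c2] : c.1 = y /\ c.2 = coord x ord_max by rewrite cE.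
case: (ord_maxVlt k) => [->|lt_kd]; first by rewrite coord_ident_max c2.
by rewrite (@coord_ident_lt _ (Ordinal lt_kd)) // c1 yE /= inord_val.
Qed.

Lemma ident_bij : bijective (@ident n d d_gt0).
Proof.
apply: inj_card_bij ident_inj _; rewrite -(card_codom ident_inj).
apply/subset_leq_card/subsetP => x _.
by have [c <-] := ident_surj x; exact: codom_f.
Qed.

(** Comparable points share their component, so being a filter is a condition on each slice
    separately. *)
Lemma filter_ident T :
  order_filter setT T <-> slice_closed (ident @: T).
Proof.
split=> [/andP[_ /forallP fT] x y | sT].
  have [[a <-] [b <-]] := (ident_surj x, ident_surj y).
  rewrite !coord_ident_max !(mem_imset _ _ ident_inj) => aT ab2.
  rewrite ident_le // => le_ab.
  have /implyP/(_ aT)/forallP/(_ b) := fT a.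
  by rewrite inE le_ab => /implyP/(_ isT).
rewrite /order_filter subsetT; apply/forallP => a; apply/implyP => aT.
apply/forallP => b; apply/implyP => _; apply/implyP => le_ab.
have /andP[/eqP ab2 _] : (a.2 == b.2) && (a.1 <= b.1)%O := le_ab.
rewrite -(mem_imset _ _ ident_inj).
apply: sT (ident a) _ _ _ _; rewrite ?mem_imset ?coord_ident_max ?ident_le //.
exact: ident_inj.
Qed.

Lemma torclosed_ident T : torclosed T <-> slice_torclosed (ident @: T).
Proof.
split=> [/forallP tT x z y | tT].
  have [[a <-] [c <-] [b <-]] := And3 (ident_surj x) (ident_surj z) (ident_surj y).
  rewrite !coord_ident_max !(mem_imset _ _ ident_inj) => aT cT lt_ac zi yx bc2.
  (* Since i < j < n, the successor of i is again an index. *)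
  have lt_kn : a.2.+1 < n by have := ltn_ord c.2; lia.
  have ab1 : b.1 = a.1.
    apply: coord_inj => k; have := yx (widen_ord (leqnSn d) k) (ltn_ord k).
    by rewrite !(@coord_ident_lt _ k) // => ->.
  have c1 : c.1 = diag d (Ordinal lt_kn).
    apply: coord_inj => k; have := zi (widen_ord (leqnSn d) k) (ltn_ord k).
    by rewrite !(@coord_ident_lt _ k) // => ->; rewrite /coord tnth_nseq.
  have := tT a.2 => /forallP/(_ c.2)/forallP/(_ (Ordinal lt_kn)).
  move=> /forallP/(_ a.1)/implyP.
  rewrite lt_ac eqxx /= -c1 -!surjective_pairing !(mem_imset _ _ val_inj).
  by rewrite aT cT -ab1 -bc2 -surjective_pairing (mem_imset _ _ val_inj); apply.
apply/forallP => i; apply/forallP => j; apply/forallP => k; apply/forallP => x.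
apply/implyP => /and4P[lt_ij /eqP ki /imsetP[a aT aE] /imsetP[c cT cE]].
have [a1 a2] : a.1 = x /\ a.2 = i by rewrite -aE.
have [c1 c2] : c.1 = diag d k /\ c.2 = j by rewrite -cE.
(* The pair (x, j) is a genuine element because x lies below the diagonal element at i, and i <
   j. *)
have [l|b bE] := @Cpos_of_pair x j.
  apply: leq_trans (ltnW lt_ij); have := cval_le a; rewrite leEos a1 a2.
  by move/forallP/(_ l); rewrite [coord (diag_chain _ _ _ _) l]tnth_nseq.
have [b1 b2] : b.1 = x /\ b.2 = j by rewrite bE.
rewrite -bE (mem_imset _ _ val_inj) -(mem_imset _ _ ident_inj).
apply: (tT (ident a) (ident c)); rewrite ?coord_ident_max ?a2 ?c2 //.
- by rewrite mem_imset //; exact: ident_inj.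
- by rewrite mem_imset //; exact: ident_inj.
- move=> l lt_ld; rewrite (@coord_ident_lt _ (Ordinal lt_ld)) // c1.
  by rewrite /coord tnth_nseq.
- by move=> l lt_ld; rewrite !(@coord_ident_lt _ (Ordinal lt_ld)) // a1 b1.
Qed.

Lemma ident_Tam T : (ident @: T \in L n d) = (T \in Tam (diag_chain n d d_gt0)).
Proof.
rewrite [RHS]inE; apply/in_L/andP => [[sT iT] | [/filter_ident sT /torclosed_ident tT]].
  split; first exact/filter_ident.
  exact/torclosed_ident/interlace_slice_torclosed.
by split; last exact: slice_torclosed_interlace.
Qed.

End Ident.

Theorem theorem4p16 (n d : nat) (n_gt0 : 0 < n) (d_gt0 : 0 < d) :
  [/\ bijective (@ident n d d_gt0),
      [set ident @: (T : {set Cpos (diag_chain n d d_gt0)})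
         | T in Tam (diag_chain n d d_gt0)] = L n d
    & {in Tam (diag_chain n d d_gt0) &,
         forall T U : {set Cpos (diag_chain n d d_gt0)},
         (ident @: T \subset ident @: U) = (T \subset U)}].
Proof.
split; first exact: ident_bij.
  apply/setP => U; apply/imsetP/idP => [[T TT ->] | UL]; first by rewrite ident_Tam.
  (* By surjectivity every subset is the image of its preimage, which serves as the witness. *)
  have UE : U = ident @: ((@ident n d d_gt0) @^-1: U).
    apply/setP => x; have [c <-] := ident_surj d_gt0 x.
    by rewrite (mem_imset _ _ (@ident_inj _ _ _)) inE.
  by exists (ident @^-1: U); rewrite // -ident_Tam -UE.
move=> T U _ _; apply/idP/idP => [/subsetP sTU | ]; last exact: imsetS.
apply/subsetP => c cT.
by rewrite -(mem_imset _ _ (@ident_inj _ _ _)) sTU // imset_f.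
Qed.
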